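(* Let $G$ be a finite graph and $v_0\in V(G)$. Then there exists an independent set $A_0$ of $G$ with $v_0\in A_0$ such that for every fractional coloring $(x_A)_{A\in S(G)}$ of $G$ there is a vertex $v\in A_0$ with $$\sum_{A\in S(G):\ N(v)\cap A\neq\emptyset} x_A\ \ge\ \chi^*(G)-1.$$
   Context: $S(G)$ denotes the set of independent sets of $G$ and $N(v)$ the set of neighbors of $v$. A fractional coloring of $G$ is a family of reals $(x_A)_{A\in S(G)}$ with $x_A\ge 0$ for all $A$ and $\sum_{A\in S(G):\,v\in A}x_A\ge 1$ for every vertex $v$. The fractional chromatic number $\chi^*(G)$ is the minimum of $\sum_{A\in S(G)}x_A$ over all fractional colorings of $G$. *)

(* Defs.v *)
From HB Require Import structures.
From mathcomp Require Import all_boot all_order all_algebra.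
From mathcomp Require Import all_classical all_reals topology normedtype derive.

Set Implicit Arguments.
Unset Strict Implicit.
Unset Printing Implicit Defensive.

Import Order.TTheory GRing.Theory Num.Theory.
Import numFieldNormedType.Exports.

Local Open Scope classical_set_scope.
Local Open Scope ring_scope.

(* A finite simple graph is given by its adjacency relation [e : rel T],
   assumed symmetric and irreflexive where it is used. *)

Definition neighbors (T : finType) (e : rel T) (v : T) : {set T} :=
  [set w | e v w]%SET.

Definition independent (T : finType) (e : rel T) (A : {set T}) : bool :=
  [forall u in A, forall w in A, ~~ e u w].

Definition indep_set (T : finType) (e : rel T) : Type :=
  {A : {set T} | independent e A}.

HB.instance Definition _ (T : finType) (e : rel T) :=
  [isSub of indep_set e for @sval _ (independent e)].
HB.instance Definition _ (T : finType) (e : rel T) :=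
  [Finite of indep_set e by <:].

Definition total_weight (R : realType) (T : finType) (e : rel T)
    (x : indep_set e -> R) : R := \sum_(A : indep_set e) x A.

Definition fractional_coloring (R : realType) (T : finType) (e : rel T)
    (x : indep_set e -> R) : Prop :=
  (forall A : indep_set e, 0 <= x A) /\
  (forall v : T, 1 <= \sum_(A : indep_set e | v \in val A) x A).

(* A minimum, taken as an infimum so that it is a total function of
   the graph; [fractional_chromatic_number_min] shows that it is attained. *)
Definition fractional_chromatic_number (R : realType) (T : finType)
    (e : rel T) : R :=
  inf [set total_weight x | x in @fractional_coloring R T e].

Lemma independent_set1 (T : finType) (e : rel T) (v : T) :
  irreflexive e -> independent e [set v]%SET.
Proof.
move=> eI; apply/forall_inP => u /set1P ->.
by apply/forall_inP => w /set1P ->; rewrite eI.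
Qed.

Lemma fractional_coloring_const1 (R : realType) (T : finType) (e : rel T) :
  irreflexive e -> fractional_coloring (fun _ : indep_set e => 1 : R).
Proof.
move=> eI; split=> [A|v]; first exact: ler01.
pose B : indep_set e := Sub [set v]%SET (independent_set1 v eI).
have vB : v \in val B by rewrite SubK set11.
by rewrite (bigD1 B)//= lerDl sumr_ge0.
Qed.

Section Minimum.
Import ArrowAsProduct.

Lemma fractional_chromatic_number_min (R : realType) (T : finType)
    (e : rel T) : irreflexive e ->
  (exists x : indep_set e -> R,
     fractional_coloring x /\
     total_weight x = fractional_chromatic_number R e) /\
  (forall x : indep_set e -> R,
     fractional_coloring x ->
     fractional_chromatic_number R e <= total_weight x).
Proof.
move=> eI; set E := [set total_weight x | x in @fractional_coloring R T e].
have Elb : has_lbound E.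
  by exists 0 => _ [x [x0 _] <-]; apply: sumr_ge0.
have minE x : @fractional_coloring R T e x -> inf E <= total_weight x.
  by move=> xc; apply: ge_inf => //; exists x.
split=> //; pose one : indep_set e -> R := fun=> 1; pose M := total_weight one.
pose B := [set x : indep_set e -> R | forall A, `[0, M]%classic (x A)].
pose C := B `&` @fractional_coloring R T e.
have inB x : fractional_coloring x -> total_weight x <= M -> B x.
  move=> [x0 _] xM A; rewrite /= in_itv/= x0/=; apply: le_trans xM.
  by rewrite /total_weight (bigD1 A)//= lerDl sumr_ge0.
have sum_cont (P : pred (indep_set e)) :
    continuous (fun x : indep_set e -> R => \sum_(A | P A) x A).
  apply: continuous_big => [|A _]; first exact: add_continuous.
  exact: (@proj_continuous _ (fun=> R) A).
have cC : compact C.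
  apply: compact_closedI.
    apply: (@tychonoff _ (fun=> R) (fun=> `[0, M]%classic)) => A.
    exact: segment_compact.
  pose nneg (A : indep_set e) := [set x : indep_set e -> R | 0 <= x A].
  pose covers (v : T) := [set x : indep_set e -> R |
    1 <= \sum_(A : indep_set e | v \in val A) x A].
  rewrite (_ : fractional_coloring (e:=e) =
      \bigcap_A nneg A `&` \bigcap_v covers v).
    apply: closedI; apply: closed_bigI => i _.
      apply: (@preimage_closed _ R (fun x : indep_set e -> R => x i)
                [set y : R | 0 <= y]); last exact: closed_ge.
      by move=> x _; exact: (@proj_continuous _ (fun=> R) i).
    apply: (@preimage_closed _ R (fun x : indep_set e -> R =>
        \sum_(A : indep_set e | i \in val A) x A) [set y : R | 1 <= y]);
      last exact: closed_ge.
    by move=> x _; exact: sum_cont.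
  apply/seteqP; split=> x [x0 x1]; first by
    split=> [A _|v _]; [exact: x0|exact: x1].
  by split=> [A|v]; [exact: x0|exact: x1].
have one_col : fractional_coloring one by exact: fractional_coloring_const1.
have oneC : C one by split=> //; exact: inB.
have C0 : C !=set0 by exists one.
have [c /set_mem[_ cc] cmin] := compact_EVT_min C0 cC
  (continuous_subspaceT (sum_cont xpredT)).
exists c; split=> //; apply/eqP; rewrite eq_le minE// andbT.
apply: lb_le_inf; first by exists M; exists one => //; exact: oneC.2.
move=> _ [x xc <-]; have [xM|/ltW Mx] := leP (total_weight x) M.
  by apply: cmin; apply/mem_set; split=> //; exact: inB.
by apply: le_trans Mx; apply: cmin; apply/mem_set.
Qed.

End Minimum.

(* Main.v *)
(* By linear programming duality there is a weighting w >= 0 of the vertices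
   with w(A) <= 1 for every independent set A and total weight at least
   chi^*(G).  Raising w(v0) until some constraint through v0 becomes tight gives
   an independent set A0 containing v0 with w(A0) = 1; this A0 does not depend on
   the coloring.  For every independent A, the set A u (A0 \ N(A)) is independent,
   hence w(A \ A0) <= w(A0 n N(A)).  Summing with the coefficients x_A gives
     chi^*(G) - 1 <= w(V \ A0) <= sum_(v in A0) w(v) W(v),
   where W(v) is the x-weight of the independent sets meeting N(v).  The right
   hand side is a weighted average of W over A0.

   For the duality, let w be an optimal weighting, of total weight c.  If
   c < chi^*(G), minimize the squared deficit sum_v max(0, 1 - x(v))^2 over all
   x >= 0 of total weight at most c, where x(v) is the x-weight of the sets
   containing v.  The vector of deficits at the minimum is, up to scaling, a
   weighting better than w. *)

Require Import Defs.
(* [all_boot] comes after [all_classical] so that [set0] is the finite set. *)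
From mathcomp Require Import all_classical topology normedtype derive.
From mathcomp Require Import all_boot all_order all_algebra.
From mathcomp Require Import reals.
From mathcomp Require Import ring lra.

Import Order.TTheory GRing.Theory Num.Theory.
Import numFieldNormedType.Exports.

Local Open Scope ring_scope.

(** * Packing polytopes and their extrema *)

Section PackingPolytope.
Import ArrowAsProduct.
Local Open Scope classical_set_scope.

Lemma sum_coord_continuous {R : realType} {I : finType} (P : pred I) :
  continuous (fun x : I -> R => \sum_(i | P i) x i).
Proof.
apply: continuous_big => [|i _]; first exact: add_continuous.
exact: (@proj_continuous _ (fun=> R) i).
Qed.

(** Used twice: with one constraint per independent set, for weightings of the vertices, and with a
    single constraint indexed by [unit], for weights on independent sets of bounded total. *)
Definition packing {R : realType} {I J : finType} (P : J -> pred I) (b : R) :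
    set (I -> R) :=
  [set x | (forall i, 0 <= x i) /\ (forall j, \sum_(i | P j i) x i <= b)].

(** Each coordinate occurs in a constraint with nonnegative terms, hence lies in [[0, b]], and
    Tychonoff's theorem applies. *)
Lemma packing_compact {R : realType} {I J : finType} (P : J -> pred I) (b : R) :
  (forall i, exists j, P j i) -> compact (packing P b).
Proof.
move=> cov.
pose B := [set x : I -> R | forall i, `[0, b]%classic (x i)].
have -> : packing P b =
    B `&` \bigcap_j [set x : I -> R | \sum_(i | P j i) x i <= b].
  apply/seteqP; split=> x.
    move=> [x0 xb]; split=> [i|j _]; last exact: xb.
    have [j Pji] := cov i; rewrite /= in_itv/= x0/=.
    by apply: le_trans (xb j); rewrite (bigD1 i)//= lerDl sumr_ge0.
  move=> [xB xb]; split=> [i|j]; last exact: xb.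
  by have := xB i; rewrite /= in_itv/= => /andP[].
apply: compact_closedI.
  apply: (@tychonoff _ (fun=> R) (fun=> `[0, b]%classic)) => i.
  exact: segment_compact.
apply: closed_bigI => j _.
apply: (@preimage_closed _ R (fun x : I -> R => \sum_(i | P j i) x i)
  [set y : R | y <= b]); last exact: closed_le.
by move=> x _; exact: sum_coord_continuous.
Qed.

Lemma packing_min {R : realType} {I J : finType} (P : J -> pred I) (b : R)
    (f : (I -> R) -> R) :
  (forall i, exists j, P j i) -> 0 <= b -> continuous f ->
  exists2 x, packing P b x & forall y, packing P b y -> f x <= f y.
Proof.
move=> cov b0 cf.
have P0 : packing P b !=set0.
  by exists (fun=> 0); split=> // j; rewrite big1.
have [x /set_mem xP xmin] := compact_EVT_min P0 (packing_compact P b cov)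
  (continuous_subspaceT cf).
by exists x => // y yP; apply: xmin; apply/mem_set.
Qed.

Lemma packing_max_sum {R : realType} {I J : finType} (P : J -> pred I) (b : R) :
  (forall i, exists j, P j i) -> 0 <= b ->
  exists2 x, packing P b x &
    forall y, packing P b y -> \sum_i y i <= \sum_i x i.
Proof.
move=> cov b0.
have [|x xP xmin] := packing_min P b (fun x => - \sum_i x i) cov b0.
  move=> x.
  apply: (@continuous_comp _ _ _ (fun x : I -> R => \sum_i x i) (@GRing.opp R)).
    exact: sum_coord_continuous.
  exact: opp_continuous.
by exists x => // y yP; rewrite -lerN2; exact: xmin.
Qed.

End PackingPolytope.

(** * The squared deficit and its first-order condition *)

Section Deficit.
Import ArrowAsProduct.

Definition deficit {R : realType} (z : R) : R := Num.max 0 (1 - z).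

Lemma deficit_ge0 {R : realType} (z : R) : 0 <= deficit z.
Proof. by rewrite /deficit le_max lexx. Qed.

Lemma deficit_eq0 {R : realType} (z : R) : deficit z = 0 -> 1 <= z.
Proof. by rewrite /deficit maxEle; case: ifPn => h; lra. Qed.

Lemma deficitM {R : realType} (z : R) :
  deficit z * z = deficit z - deficit z ^+ 2.
Proof. by rewrite /deficit maxEle; case: ifPn => h; ring. Qed.

(** The derivative of [deficit z ^+ 2] is -2 [deficit z], which is 2-Lipschitz; hence this quadratic
    upper bound. *)
Lemma deficit_sqr_le {R : realType} (z h : R) :
  deficit (z + h) ^+ 2 <= deficit z ^+ 2 - deficit z * h *+ 2 + h ^+ 2.
Proof. by rewrite /deficit !maxEle; case: ifPn => h1; case: ifPn => h2; nra. Qed.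

Lemma deficit_continuous {R : realType} : continuous (deficit (R := R)).
Proof.
move=> z; apply: (@continuous_max R R (fun=> 0) (fun z => 1 - z)).
  exact: cvg_cst.
by apply: cvgB; [exact: cvg_cst|exact: cvg_id].
Qed.

Lemma sum_deficit_continuous {R : realType} {I T : finType} (P : T -> pred I) :
  continuous (fun x : I -> R => \sum_v deficit (\sum_(i | P v i) x i) ^+ 2).
Proof.
apply: continuous_big => [|v _]; first exact: add_continuous.
move=> x; apply: (@continuous_comp _ _ _ (fun x : I -> R => \sum_(i | P v i) x i)
  (fun z => deficit z ^+ 2)); first exact: sum_coord_continuous.
apply: (@continuous_comp _ _ _ (deficit (R := R)) (fun z : R => z ^+ 2)).
  exact: deficit_continuous.
by rewrite /prop_for /continuous_at expr2; apply: cvgM; exact: cvg_id.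
Qed.

End Deficit.

Lemma le0_linear_bound {R : realType} {a k : R} :
  (forall t, 0 < t -> t <= 1 -> a <= t * k) -> a <= 0.
Proof.
move=> h; rewrite leNgt; apply/negP => a0.
have k0 : 0 < k by have := h 1 ltr01 (lexx _); lra.
have ak : a <= k by have := h 1 ltr01 (lexx _); lra.
(* At this [t] the hypothesis reads [a <= a / 2]. *)
have t0 : 0 < a / k / 2 by rewrite !divr_gt0.
have t1 : a / k / 2 <= 1.
  have : a / k <= 1 by rewrite ler_pdivrMr ?mul1r.
  lra.
have := h _ t0 t1.
have -> : a / k / 2 * k = a / 2 by field; rewrite gt_eqF.
lra.
Qed.

Lemma sum_indicator {R : realType} {I : finType} (P : pred I) (j : I) :
  \sum_(i | P i) (i == j)%:R = (P j)%:R :> R.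
Proof.
rewrite big_mkcond (bigD1 j)//= eqxx big1 ?addr0; first by case: (P j).
by move=> i /negPf ->; case: (P i).
Qed.

(* First-order optimality in the direction from x to c times the indicator
   of A. *)
Lemma deficit_optimality {R : realType} {T : finType} {e : rel T} {c : R}
    {x : indep_set e -> R}
    (w := fun v => deficit (\sum_(A : indep_set e | v \in val A) x A)) :
  0 <= c -> (forall A, 0 <= x A) -> \sum_A x A <= c ->
  (forall y : indep_set e -> R, (forall A, 0 <= y A) -> \sum_A y A <= c ->
    \sum_v deficit (\sum_(A : indep_set e | v \in val A) x A) ^+ 2 <=
    \sum_v deficit (\sum_(A : indep_set e | v \in val A) y A) ^+ 2) ->
  forall A : indep_set e, c * \sum_(v in val A) w v <=
    \sum_v w v * \sum_(B : indep_set e | v \in val B) x B.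
Proof.
move=> c0 x0 xc xmin A; rewrite -subr_le0.
pose X v := \sum_(B : indep_set e | v \in val B) x B.
(* The rate of change of the weight covering [v] in this direction. *)
pose z v := c * (v \in val A)%:R - X v.
have -> : c * \sum_(v in val A) w v - \sum_v w v * X v = \sum_v w v * z v.
  rewrite mulr_sumr big_mkcond -sumrB; apply: eq_bigr => v _.
  by rewrite /z; case: (v \in val A) => /=; ring.
suff h t : 0 < t -> t <= 1 -> (\sum_v w v * z v) *+ 2 <= t * \sum_v z v ^+ 2.
  by have := le0_linear_bound h; lra.
move=> t0 t1.
(* A convex combination of two admissible points. *)
pose y B := x B + t * (c * (B == A)%:R - x B).
have y0 B : 0 <= y B.
  have := x0 B; rewrite /y; case: (B == A) => /=; nra.
have sumA (P : pred (indep_set e)) :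
    \sum_(B | P B) y B =
    \sum_(B | P B) x B + t * (c * (P A)%:R - \sum_(B | P B) x B).
  rewrite big_split/= -mulr_sumr sumrB -mulr_sumr; congr (_ + t * (c * _ - _)).
  exact: sum_indicator.
have yc : \sum_B y B <= c by rewrite sumA /=; nra.
have := xmin y y0 yc; rewrite -subr_ge0 -sumrB => h.
have : 0 <= \sum_v (t ^+ 2 * z v ^+ 2 - t * (w v * z v) *+ 2).
  apply: le_trans h _; apply: ler_sum => v _; rewrite sumA -/(X v) -/(z v).
  by have := deficit_sqr_le (X v) (t * z v); rewrite /w -/(X v); lra.
rewrite sumrB -mulr_sumr sumrMnl -mulr_sumr; nra.
Qed.

(** * Linear programming duality *)

Lemma fractional_clique_exists {R : realType} {T : finType} {e : rel T} :
  irreflexive e ->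
  exists w : T -> R,
    [/\ forall v, 0 <= w v,
        forall A : indep_set e, \sum_(v in val A) w v <= 1 &
        fractional_chromatic_number R e <= \sum_v w v].
Proof.
move=> eI.
pose single v : indep_set e := Sub [set v]%SET (independent_set1 v eI).
have cov v : exists A : indep_set e, v \in val A.
  by exists (single v); rewrite SubK set11.
have [w [w0 wA] wmax] := packing_max_sum (R := R)
  (fun (A : indep_set e) v => v \in val A) 1 cov ler01.
exists w; split=> //; rewrite leNgt; apply/negP => mlt.
set c := \sum_v w v in mlt.
have c0 : 0 <= c by apply: sumr_ge0.
have [x [x0 xc'] xmin] := packing_min (fun _ : unit => xpredT) c
  (fun x => \sum_v deficit (\sum_(A : indep_set e | v \in val A) x A) ^+ 2)
  (fun=> ex_intro _ tt isT) c0
  (sum_deficit_continuous (fun (v : T) (A : indep_set e) => v \in val A)).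
have xc := xc' tt.
pose X v := \sum_(A : indep_set e | v \in val A) x A.
pose u v := deficit (X v).
have u0 v : 0 <= u v by exact: deficit_ge0.
have [v0 uv0] : exists v, 0 < u v.
  apply: contrapT => /forallNP h.
  have xcol : fractional_coloring x.
    split=> // v; apply: deficit_eq0; apply/eqP.
    by rewrite eq_le deficit_ge0 andbT leNgt; apply/negP; exact: h.
  have := (fractional_chromatic_number_min R eI).2 x xcol.
  by rewrite leNgt (le_lt_trans _ mlt).
have opt := deficit_optimality c0 x0 xc
  (fun y y0 yc => xmin y (conj y0 (fun _ : unit => yc))).
set Q := \sum_v _ in opt.
(* By [deficitM] the gap is the sum of the squared deficits. *)
have QS : Q < \sum_v u v.
  rewrite -subr_gt0 -sumrB (bigD1 v0)//= ltr_pwDl//.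
    by rewrite deficitM opprB addrCA subrr addr0 exprn_gt0.
  by apply: sumr_ge0 => v _; rewrite deficitM opprB addrCA subrr addr0 sqr_ge0.
have sum1 (v : T) (f : T -> R) : \sum_(i in val (single v)) f i = f v.
  by rewrite SubK big_set1.
(* The indicator of [v0] competes with [w]. *)
have c1 : 1 <= c.
  have := wmax (fun v => (v == v0)%:R).
  rewrite sum_indicator; apply; split=> [v|A]; first exact: ler0n.
  by rewrite sum_indicator lern1 leq_b1.
have cp : 0 < c := lt_le_trans ltr01 c1.
have Q0 : 0 < Q.
  by apply: lt_le_trans (opt (single v0)); rewrite sum1 mulr_gt0.
(* By [opt] this rescaling of [u] is a packing; by [QS] its total exceeds [c]. *)
have := wmax (fun v => c / Q * u v); rewrite -mulr_sumr => h.
have : c / Q * \sum_v u v <= c.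
  apply: h; split=> [v|A]; first by rewrite mulr_ge0// divr_ge0// ltW.
  by rewrite -mulr_sumr mulrAC ler_pdivrMr// mul1r; exact: opt.
by rewrite mulrAC ler_pdivrMr// ler_pM2l// leNgt QS.
Qed.

(** * A tight independent set and the exchange inequality *)

Lemma fractional_clique_tight {R : realType} {T : finType} {e : rel T} (v0 : T) :
  irreflexive e ->
  exists (w : T -> R) (A0 : indep_set e),
    [/\ forall v, 0 <= w v,
        forall A : indep_set e, \sum_(v in val A) w v <= 1,
        fractional_chromatic_number R e <= \sum_v w v,
        v0 \in val A0 & \sum_(v in val A0) w v = 1].
Proof.
move=> eI; have [w [w0 wA wX]] := fractional_clique_exists (R := R) eI.
pose B0 : indep_set e := Sub [set v0]%SET (independent_set1 v0 eI).
have vB0 : v0 \in val B0 by rewrite SubK set11.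
(* [A0] is heaviest among the independent sets through [v0], so its slack [d] is the smallest and
   can be added to [w v0]. *)
have [A0 vA0 A0max] := @arg_maxP _ R (indep_set e) B0 (fun A => v0 \in val A)
  (fun A => \sum_(v in val A) w v) vB0.
set d := 1 - \sum_(v in val A0) w v.
have d0 : 0 <= d by rewrite subr_ge0.
pose w' v := w v + d * (v == v0)%:R.
have s (P : pred T) : \sum_(v | P v) w' v = \sum_(v | P v) w v + d * (P v0)%:R.
  by rewrite big_split/= -mulr_sumr sum_indicator.
exists w', A0; split=> // [v|A||].
- by rewrite addr_ge0 ?mulr_ge0.
- rewrite s; have [vA|vA] := boolP (v0 \in val A); last by rewrite mulr0 addr0.
  by have := A0max A vA; rewrite /d/=; lra.
- by rewrite s mulr1; lra.
- by rewrite s vA0 mulr1 addrC subrK.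
Qed.

Lemma independent_exchange {T : finType} {e : rel T} {A B : {set T}} :
  symmetric e -> independent e A -> independent e B ->
  independent e (A :|: [set v in B | neighbors e v :&: A == set0])%SET.
Proof.
move=> eS /forall_inP iA /forall_inP iB.
have far u w : u \in A -> neighbors e w :&: A = set0 -> ~~ e w u.
  move=> uA /setP/(_ u); rewrite !inE uA andbT => -> //.
apply/forall_inP => u /setUP[uA|]; last rewrite inE => /andP[uB /eqP uf];
  apply/forall_inP => w /setUP[wA|]; try (rewrite inE => /andP[wB /eqP wf]).
- exact: (forall_inP (iA u uA)).
- by rewrite eS; exact: far.
- exact: far.
- exact: (forall_inP (iB u uB)).
Qed.

Lemma tight_exchange {R : realType} {T : finType} {e : rel T} {w : T -> R}
    {A0 : indep_set e} (A : indep_set e) :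
  symmetric e ->
  (forall B : indep_set e, \sum_(v in val B) w v <= \sum_(v in val A0) w v) ->
  \sum_(v in val A | v \notin val A0) w v <=
  \sum_(v in val A0 | neighbors e v :&: val A != set0) w v.
Proof.
move=> eS wA.
pose B : indep_set e := Sub _ (independent_exchange eS (valP A) (valP A0)).
have := wA B; rewrite SubK (bigID (mem (val A0)))/=.
rewrite [X in _ <= X](bigID (fun v => neighbors e v :&: val A == set0))/=.
have iA : forall u v, u \in val A -> v \in val A -> ~~ e u v.
  by move=> u v uA vA; exact: (forall_inP (forall_inP (valP A) u uA)).
(* [B] meets [A0] exactly in the vertices without neighbors in [A]: those of [A] itself qualify, as
   [A] is independent. *)
rewrite (eq_bigl (fun v => (v \in val A0) && (neighbors e v :&: val A == set0))).
  rewrite lerD2l (eq_bigl (fun v => (v \in val A) && (v \notin val A0)))// => v.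
  by rewrite !inE; case: (v \in val A0); rewrite ?andbF ?orbF.
move=> v; rewrite !inE andbC; case: (v \in val A0) => //=.
case: (boolP (v \in val A)) => //= vA; apply/esym/eqP/setP => u.
rewrite !inE; apply/negbTE/negP => /andP[evu uA].
by have := iA v u vA uA; rewrite evu.
Qed.

(** * Averaging over the tight set *)

Theorem theorem2 (R : realType) (T : finType) (e : rel T)
    (e_sym : symmetric e) (e_irr : irreflexive e) (v0 : T) :
  exists A0 : indep_set e,
    v0 \in val A0 /\
    forall x : indep_set e -> R, fractional_coloring x ->
      exists v : T,
        v \in val A0 /\
        \sum_(A : indep_set e | neighbors e v :&: val A != set0) x A
          >= fractional_chromatic_number R e - 1.
Proof.
have [w [A0 [w0 wA wX vA0 wA0]]] := fractional_clique_tight (R := R) v0 e_irr.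
exists A0; split=> // x [x0 x1].
set k := _ - 1.
pose W v := \sum_(A : indep_set e | neighbors e v :&: val A != set0) x A.
apply: contrapT => /forallNP h.
have Wlt v : v \in val A0 -> W v < k.
  by move=> vA; rewrite ltNge; apply/negP => kW; apply: (h v).
have lower : k <= \sum_(v | v \notin val A0)
    w v * \sum_(A : indep_set e | v \in val A) x A.
  apply: (@le_trans _ _ (\sum_(v | v \notin val A0) w v)).
    by move: wX; rewrite /k (bigID (mem (val A0)))/= wA0; lra.
  by apply: ler_sum => v _; rewrite ler_peMr.
have upper : \sum_(v in val A0) w v * W v < k.
  rewrite -[ltRHS]mul1r -wA0 mulr_suml.
  (* A vertex of positive weight makes the averaged inequality strict. *)
  have [v vA wv] : exists2 v, v \in val A0 & 0 < w v.
    apply: contrapT => hw.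
    have : \sum_(v in val A0) w v = 0.
      apply: big1 => v vA; apply/eqP; rewrite eq_le w0 andbT leNgt.
      by apply/negP => wv; apply: hw; exists v.
    by rewrite wA0 => /eqP; rewrite oner_eq0.
  rewrite [ltLHS](bigD1 v)//= [ltRHS](bigD1 v)//= ltr_leD//.
    by rewrite ltr_pM2l// Wlt.
  by apply: ler_sum => u /andP[uA _]; rewrite ler_wpM2l// ltW// Wlt.
suff : \sum_(v | v \notin val A0)
    w v * \sum_(A : indep_set e | v \in val A) x A <=
    \sum_(v in val A0) w v * W v by lra.
(* Summing over independent sets first reduces the claim to [tight_exchange] for each [A]. *)
have swap (P : pred T) (r : T -> pred (indep_set e)) :
    \sum_(v | P v) w v * \sum_(A | r v A) x A =
    \sum_A x A * \sum_(v | P v && r v A) w v.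
  under eq_bigr do rewrite mulr_sumr.
  rewrite (exchange_big_dep xpredT)//=; apply: eq_bigr => A _.
  by rewrite mulr_sumr; apply: eq_bigr => v _; rewrite mulrC.
rewrite !swap; apply: ler_sum => A _; rewrite ler_wpM2l//.
under eq_bigl do rewrite andbC.
by apply: tight_exchange => // B; rewrite wA0.
Qed.
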